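(* Let $\alpha\le\beta$ be two antichains in $\mathcal{D}_n$, and let $(\chi_0,\upsilon_0)$ be a partition of $\beta-\alpha$ such that any two sets $A,B\in\beta-\alpha$ that are connected with respect to $\alpha$ are in the same component of the partition. With the partition $(\chi_0,\upsilon_0)$ corresponds exactly one solution $(\chi,\upsilon)$ of the system $$\chi\wedge\upsilon=\alpha,\qquad \chi\vee\upsilon=\beta$$ in antichains $\chi,\upsilon\in\mathcal{D}_n$, and any solution of this system corresponds with exactly one such partition.
   Context: Let $n\ge 0$ and $\mathcal{A}=\{1,\dots,n\}$. An antichain over $\mathcal{A}$ is a set of pairwise non-inclusive subsets of $\mathcal{A}$ (the empty set of subsets $\{\}$ and the singleton $\{\emptyset\}$ are both antichains). $\mathcal{D}_n$ is the set of all antichains over $\mathcal{A}$, partially ordered by: $\alpha\le\beta$ iff for every $X\in\alpha$ there is $Y\in\beta$ with $X\subseteq Y$. For a set $S$ of subsets of $\mathcal{A}$, $\max(S)$ is the set of inclusion-maximal members of $S$. Join and meet are $\alpha\vee\beta=\max(\alpha\cup\beta)$ and $\alpha\wedge\beta=\max(\{X\cap Y: X\in\alpha, Y\in\beta\})$. The symbol $-$ denotes set difference of antichains regarded as sets of subsets of $\mathcal{A}$. For $\alpha\le\beta$, two sets $A,B\in\beta-\alpha$ are directly connected with respect to $\alpha$ iff $\{A\cap B\}\not\le\alpha$. They are connected with respect to $\alpha$ iff they are directly connected with respect to $\alpha$ or there exist $x\ge 1$ and $Z_1,\dots,Z_x\in\beta-\alpha$ such that $A$ is directly connected with $Z_1$,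 $B$ is directly connected with $Z_x$, and $Z_i$ is directly connected with $Z_{i+1}$ for $1\le i\le x-1$, all with respect to $\alpha$. Partitions $(\chi_0,\upsilon_0)$ are ordered pairs of disjoint, possibly empty, sets with union $\beta-\alpha$. *)

(* Defs.v *)
From HB Require Import structures.
From mathcomp Require Import all_boot all_order.

Set Implicit Arguments.
Unset Strict Implicit.
Unset Printing Implicit Defensive.

Import Order.Theory.
Local Open Scope order_scope.

(* The ground set {1, ..., n} is rendered as 'I_n = {0, ..., n-1}. *)

Definition is_antichain (n : nat) (S : {set {set 'I_n}}) : bool :=
  [forall X in S, forall Y in S, (X \subset Y) ==> (X == Y)].

Record antichain (n : nat) := Antichain {
  achain :> {set {set 'I_n}};
  antichainP : is_antichain achain
}.

HB.instance Definition _ n := [isSub for @achain n].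
HB.instance Definition _ n := [Finite of antichain n by <:].

Definition max_members (n : nat) (S : {set {set 'I_n}}) : {set {set 'I_n}} :=
  [set X | maxset [in S] X].

Lemma max_members_antichain (n : nat) (S : {set {set 'I_n}}) :
  is_antichain (max_members S).
Proof.
apply/forall_inP => X; rewrite inE => /maxsetP[_ maxX].
apply/forall_inP => Y; rewrite inE => /maxsetP[SY _].
by apply/implyP => sXY; rewrite (maxX Y).
Qed.

Definition max_antichain (n : nat) (S : {set {set 'I_n}}) : antichain n :=
  Antichain (max_members_antichain S).

Lemma set1_antichain (n : nat) (X : {set 'I_n}) : is_antichain [set X].
Proof.
apply/forall_inP => Y /set1P->; apply/forall_inP => Z /set1P->.
by rewrite eqxx implybT.
Qed.

Definition single (n : nat) (X : {set 'I_n}) : antichain n :=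
  Antichain (set1_antichain X).

Definition antichain_le (n : nat) (a b : antichain n) : bool :=
  [forall X in achain a, exists Y in achain b, X \subset Y].

Definition antichain_join (n : nat) (a b : antichain n) : antichain n :=
  max_antichain (achain a :|: achain b).

Definition antichain_meet (n : nat) (a b : antichain n) : antichain n :=
  max_antichain [set X :&: Y | X in achain a, Y in achain b].

Lemma antichain_leP (n : nat) (a b : antichain n) :
  reflect (forall X, X \in achain a -> exists2 Y, Y \in achain b & X \subset Y)
          (antichain_le a b).
Proof.
by apply: (iffP forall_inP) => le_ab X /le_ab /exists_inP.
Qed.

Lemma antichain_le_refl (n : nat) : reflexive (@antichain_le n).
Proof. by move=> a; apply/antichain_leP => X aX; exists X. Qed.

Lemma antichain_le_trans (n : nat) : transitive (@antichain_le n).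
Proof.
move=> b a c /antichain_leP le_ab /antichain_leP le_bc.
apply/antichain_leP => X /le_ab[Y /le_bc[Z cZ sYZ] sXY].
by exists Z; rewrite // (subset_trans sXY).
Qed.

Lemma antichain_le_anti (n : nat) : antisymmetric (@antichain_le n).
Proof.
suff sub (a b : antichain n) :
    antichain_le a b -> antichain_le b a -> achain a \subset achain b.
  move=> a b /andP[le_ab le_ba].
  by apply/val_inj/eqP; rewrite eqEsubset !sub.
move=> /antichain_leP le_ab /antichain_leP le_ba.
apply/subsetP => X aX; have [Y bY sXY] := le_ab X aX.
have [Z aZ sYZ] := le_ba Y bY.
have/forall_inP/(_ X aX)/forall_inP/(_ Z aZ) := antichainP a.
rewrite (subset_trans sXY sYZ) /= => /eqP eXZ.
suff -> : X = Y by [].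
by apply/eqP; rewrite eqEsubset sXY eXZ sYZ.
Qed.

Fact antichain_display : Order.disp_t. Proof. exact: Order.Disp tt tt. Qed.

HB.instance Definition _ n :=
  Order.Le_isPOrder.Build antichain_display (antichain n)
    (@antichain_le_refl n) (@antichain_le_anti n) (@antichain_le_trans n).

Lemma leacP (n : nat) (a b : antichain n) :
  reflect (forall X, X \in achain a -> exists2 Y, Y \in achain b & X \subset Y)
          (a <= b).
Proof. exact: antichain_leP. Qed.

Lemma max_antichain_leP (n : nat) (S : {set {set 'I_n}}) (b : antichain n) :
  reflect (forall X, X \in S -> exists2 Y, Y \in achain b & X \subset Y)
          (max_antichain S <= b).
Proof.
apply: (iffP (leacP _ _)) => le_Sb X.
  move=> SX; have [Z maxZ sXZ] := maxset_exists (P := [in S]) SX.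
  have [|Y bY sZY] := le_Sb Z; first by rewrite inE.
  by exists Y; rewrite // (subset_trans sXZ).
by rewrite inE => /maxsetp /le_Sb.
Qed.

Lemma le_max_antichainP (n : nat) (S : {set {set 'I_n}}) (a : antichain n) :
  reflect (forall X, X \in achain a -> exists2 Y, Y \in S & X \subset Y)
          (a <= max_antichain S).
Proof.
apply: (iffP (leacP _ _)) => le_aS X /le_aS[Y SY sXY].
  by exists Y => //; move: SY; rewrite inE => /maxsetp.
have [Z maxZ sYZ] := maxset_exists (P := [in S]) SY.
by exists Z; rewrite ?inE // (subset_trans sXY).
Qed.

Lemma le_antichain_meet (n : nat) (a b c : antichain n) :
  (a <= antichain_meet b c) = (a <= b) && (a <= c).
Proof.
apply/le_max_antichainP/andP => [le_a | [/leacP le_ab /leacP le_ac] X aX].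
  by split; apply/leacP => X /le_a[_ /imset2P[Y Z bY cZ ->]];
    rewrite subsetI => /andP[sXY sXZ]; [exists Y | exists Z].
have [[Y bY sXY] [Z cZ sXZ]] := (le_ab X aX, le_ac X aX).
by exists (Y :&: Z); [apply: imset2_f | rewrite subsetI sXY].
Qed.

Lemma antichain_join_le (n : nat) (a b c : antichain n) :
  (antichain_join a b <= c) = (a <= c) && (b <= c).
Proof.
apply/max_antichain_leP/andP => [le_c | [/leacP le_ac /leacP le_bc] X].
  by split; apply/leacP => X abX; apply: le_c; rewrite inE abX ?orbT.
by rewrite inE => /orP[/le_ac | /le_bc].
Qed.

HB.instance Definition _ n :=
  Order.POrder_MeetJoin_isLattice.Build antichain_display (antichain n)
    (@le_antichain_meet n) (@antichain_join_le n).

Lemma joinacE (n : nat) (a b : antichain n) :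
  a `|` b = max_antichain (achain a :|: achain b).
Proof. by []. Qed.

Lemma meetacE (n : nat) (a b : antichain n) :
  a `&` b = max_antichain [set X :&: Y | X in achain a, Y in achain b].
Proof. by []. Qed.

Lemma antichain_meetUl (n : nat) :
  left_distributive (@Order.meet _ (antichain n)) (@Order.join _ (antichain n)).
Proof.
move=> a b c; apply: le_anti; apply/andP; split; last first.
  by rewrite leUx !leI2 ?leUl ?leUr.
rewrite meetacE; apply/max_antichain_leP => _ /imset2P[X Z abX cZ ->].
move: abX; rewrite joinacE inE => /maxsetp; rewrite /= inE => abX.
suff /leacP : single (X :&: Z) <= (a `&` c) `|` (b `&` c).
  by apply; rewrite inE.
have sZ : single (X :&: Z) <= c.
  by apply/leacP => _ /set1P->; exists Z; rewrite ?subsetIr.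
by case/orP: abX => abX; [apply: lexUl | apply: lexUr]; rewrite lexI sZ andbT;
  apply/leacP => _ /set1P->; exists X; rewrite ?subsetIl.
Qed.

HB.instance Definition _ n :=
  Order.Lattice_Meet_isDistrLattice.Build antichain_display (antichain n)
    (@antichain_meetUl n).

Definition directly_connected (n : nat) (alpha : antichain n)
    (A B : {set 'I_n}) : bool :=
  ~~ (single (A :&: B) <= alpha).

(* The sequence Z_1, ..., Z_x with x >= 1 is rendered as Z :: Zs. *)
Definition connected (n : nat) (alpha beta : antichain n)
    (A B : {set 'I_n}) : Prop :=
  directly_connected alpha A B \/
  exists (Z : {set 'I_n}) (Zs : seq {set 'I_n}),
    [/\ {subset Z :: Zs <= achain beta :\: achain alpha},
        directly_connected alpha A Z,
        directly_connected alpha B (last Z Zs) &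
        path (directly_connected alpha) Z Zs].

Definition is_partition2 (n : nat) (S : {set {set 'I_n}})
    (p : {set {set 'I_n}} * {set {set 'I_n}}) : Prop :=
  [disjoint p.1 & p.2] /\ p.1 :|: p.2 = S.

Definition respects_connection (n : nat) (alpha beta : antichain n)
    (p : {set {set 'I_n}} * {set {set 'I_n}}) : Prop :=
  forall A B : {set 'I_n},
    A \in achain beta :\: achain alpha -> B \in achain beta :\: achain alpha ->
    connected alpha beta A B ->
    (A \in p.1 /\ B \in p.1) \/ (A \in p.2 /\ B \in p.2).

Definition admissible (n : nat) (alpha beta : antichain n)
    (p : {set {set 'I_n}} * {set {set 'I_n}}) : Prop :=
  is_partition2 (achain beta :\: achain alpha) p /\
  respects_connection alpha beta p.

Definition solution (n : nat) (alpha beta : antichain n)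
    (s : antichain n * antichain n) : Prop :=
  s.1 `&` s.2 = alpha /\ s.1 `|` s.2 = beta.

(* For a solution s and an admissible p this amounts to s.1 = p.1 `|` alpha and
   s.2 = p.2 `|` alpha, p.1 and p.2 being antichains as subsets of beta. *)
Definition corresponds (n : nat) (alpha : antichain n)
    (p : {set {set 'I_n}} * {set {set 'I_n}})
    (s : antichain n * antichain n) : Prop :=
  p.1 = achain s.1 :\: achain alpha /\ p.2 = achain s.2 :\: achain alpha.

(* Main.v *)
Require Import Defs.
From HB Require Import structures.
From mathcomp Require Import all_boot all_order.

Set Implicit Arguments.
Unset Strict Implicit.
Unset Printing Implicit Defensive.

(** Both directions rest on the fact that, for [alpha <= beta], a member of
    [beta] lying below [alpha] already belongs to [alpha] ([mem_of_le]).
    Hence every member of [beta - alpha] stays maximal when [alpha] is added,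
    so a set [S] of such members is recovered from the antichain
    [max S `|` alpha] by removing [alpha] ([join_diffK]); conversely any
    antichain above [alpha] is rebuilt from what it has outside [alpha]
    ([diff_joinK]). So a pair of parts and a solution determine each other: the
    only candidates are [(chi - alpha, upsilon - alpha)] for the parts of
    [(chi, upsilon)], and [(max S `|` alpha, max T `|` alpha)] for the solution
    of [(S, T)].

    It remains to match the equations with admissibility. In the distributive
    lattice of antichains, [(max S `|` alpha) `&` (max T `|` alpha)] is
    [(max S `&` max T) `|` alpha]. For parts [S], [T] of [beta - alpha] this
    equals [alpha] exactly when no member of [S] is directly connected with a
    member of [T] ([meet_leP]). So the meet equation says that direct
    connections never cross the partition; by induction along a path the same
    holds for connections ([connected_closed]). The join equation says that the
    two parts together exhaust [beta - alpha], once the parts of a solution are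
    known to lie in [beta - alpha], which again follows from the meet equation
    ([solution_diff_sub]). *)

Import Order.Theory.

Section AntichainLattice.

Local Open Scope order_scope.

Variable n : nat.
Implicit Types (a b c : antichain n) (S T : {set {set 'I_n}}) (A B : {set 'I_n}).

Lemma single_leP A b :
  reflect (exists2 Y, Y \in achain b & A \subset Y) (single A <= b).
Proof.
apply: (iffP (leacP _ _)) => [|sAb _ /set1P-> //].
by apply; rewrite inE.
Qed.

Lemma single_le A a : A \in achain a -> single A <= a.
Proof. by move=> aA; apply/single_leP; exists A. Qed.

Lemma antichain_eq a A B :
  A \in achain a -> B \in achain a -> A \subset B -> A = B.
Proof.
move=> aA aB sAB.
have/forall_inP/(_ A aA)/forall_inP/(_ B aB) := antichainP a.
by rewrite sAB => /eqP.
Qed.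

(** The member of [a] that contains [A] is itself contained in a member of [b],
    and the antichain property of [b] collapses this chain of inclusions. *)
Lemma mem_of_le a b A :
  a <= b -> A \in achain b -> single A <= a -> A \in achain a.
Proof.
move=> /leacP le_ab bA /single_leP[Y aY sAY].
have [Z bZ sYZ] := le_ab Y aY.
have eAZ := antichain_eq bA bZ (subset_trans sAY sYZ).
suff -> : A = Y by [].
by apply/eqP; rewrite eqEsubset sAY eAZ.
Qed.

Lemma meet_leP a b c :
  reflect (forall A B, A \in achain a -> B \in achain b -> single (A :&: B) <= c)
          (a `&` b <= c).
Proof.
rewrite meetacE; apply: (iffP (max_antichain_leP _ _)) => [le_c A B aA bB | le_c].
  by apply/single_leP/le_c/imset2_f.
by move=> _ /imset2P[A B aA bB ->]; apply/single_leP/le_c.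
Qed.

Lemma max_antichain_sub S A : A \in achain (max_antichain S) -> A \in S.
Proof. by rewrite inE => /maxsetp. Qed.

Lemma join_sub a b A :
  A \in achain (a `|` b) -> (A \in achain a) || (A \in achain b).
Proof. by rewrite joinacE => /max_antichain_sub; rewrite inE. Qed.

Lemma mem_max_antichain S A :
  A \in S -> (forall B, B \in S -> A \subset B -> B = A) ->
  A \in achain (max_antichain S).
Proof. by move=> SA maxA; rewrite inE; apply/maxsetP; split. Qed.

Lemma max_antichainU S T :
  max_antichain S `|` max_antichain T = max_antichain (S :|: T).
Proof.
have memS (U : {set {set 'I_n}}) A :
    A \in U -> exists2 Y, Y \in achain (max_antichain U) & A \subset Y.
  by move: A; apply/max_antichain_leP.
apply: le_anti; apply/andP; split.
  rewrite leUx; apply/andP; split; apply/max_antichain_leP => A inA;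
    by apply: memS; rewrite inE inA ?orbT.
apply/max_antichain_leP => A; rewrite inE => /orP[] /memS/single_leP leA;
  by apply/single_leP; rewrite (le_trans leA) ?leUl ?leUr.
Qed.

Lemma diff_joinK a c :
  a <= c -> max_antichain (achain c :\: achain a) `|` a = c.
Proof.
move=> le_ac; apply: le_anti; apply/andP; split.
  rewrite leUx le_ac andbT; apply/max_antichain_leP => A.
  by case/setDP=> cA _; exists A.
apply/leacP => A cA; apply/single_leP.
have [aA | aA] := boolP (A \in achain a).
  by apply: lexUr; apply: single_le.
apply: lexUl; apply/single_leP.
have /max_antichain_leP := lexx (max_antichain (achain c :\: achain a)).
by apply; rewrite inE aA.
Qed.

(** Members of [S] survive in the join because neither [S] nor [a] can contain
    a set strictly larger than one of them: for [S] this is the antichain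
    property of [b], for [a] it is [mem_of_le]. *)
Lemma join_diffK a b S :
  a <= b -> S \subset achain b :\: achain a ->
  achain (max_antichain S `|` a) :\: achain a = S.
Proof.
move=> le_ab /subsetP sSba; apply/setP => A; rewrite in_setD.
apply/andP/idP => [[aA] /join_sub/orP[/max_antichain_sub // | ] | SA].
  by rewrite (negbTE aA).
have /setDP[bA aA] := sSba A SA; split=> //; rewrite joinacE.
have maxA : A \in achain (max_antichain S).
  apply: mem_max_antichain => // B /sSba/setDP[bB _] sAB.
  by rewrite (antichain_eq bA bB sAB).
apply: mem_max_antichain => [|B]; first by rewrite inE maxA.
rewrite in_setU => /orP[/max_antichain_sub/sSba/setDP[bB _] | aB] sAB.
  by rewrite (antichain_eq bA bB sAB).
case/negP: aA; apply: mem_of_le bA _ => //.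
by apply/single_leP; exists B.
Qed.

Lemma directly_connected_sym a : symmetric (directly_connected a).
Proof. by move=> A B; rewrite /directly_connected setIC. Qed.

(** Reduces statements on connections to direct ones. Symmetry enters at the
    far end of the path, where [connected] links [B] to the last step and not
    the last step to [B]. *)
Lemma connected_closed a b (P : {set {set 'I_n}}) A B :
  (forall X Y, X \in P -> Y \in achain b :\: achain a ->
     directly_connected a X Y -> Y \in P) ->
  A \in P -> B \in achain b :\: achain a -> connected a b A B -> B \in P.
Proof.
move=> clP PA baB [/(clP A B PA baB) // | [Z [Zs [sZ dAZ dBZ pathZ]]]].
have PZ : Z \in P by apply: clP dAZ => //; apply: sZ; rewrite mem_head.
suff PL : last Z Zs \in P by apply: clP PL baB _; rewrite directly_connected_sym.
elim: Zs Z sZ pathZ {dAZ dBZ} PZ => //= Y Zs IH Z sZ /andP[dZY pathY] PZ.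
apply: IH => // [X YsX|]; first by apply: sZ; rewrite inE YsX orbT.
by apply: clP dZY => //; apply: sZ; rewrite !inE eqxx orbT.
Qed.

Lemma no_crossing_meet_le a S T :
  (forall A B, A \in S -> B \in T -> ~~ directly_connected a A B) ->
  max_antichain S `&` max_antichain T <= a.
Proof.
move=> ncross; apply/meet_leP => A B /max_antichain_sub SA /max_antichain_sub TB.
by have := ncross A B SA TB; rewrite negbK.
Qed.

Lemma admissible_no_crossing a b p A B :
  admissible a b p -> A \in p.1 -> B \in p.2 -> ~~ directly_connected a A B.
Proof.
case=> [[dis defS] resp] p1A p2B; apply/negP => dAB.
have baA : A \in achain b :\: achain a by rewrite -defS inE p1A.
have baB : B \in achain b :\: achain a by rewrite -defS inE p2B orbT.
have [[_ p1B] | [p2A _]] := resp A B baA baB (or_introl dAB).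
  by rewrite (disjointFr dis p1B) in p2B.
by rewrite (disjointFr dis p1A) in p2A.
Qed.

Lemma admissible_solution a b p :
  a <= b -> admissible a b p ->
  solution a b (max_antichain p.1 `|` a, max_antichain p.2 `|` a).
Proof.
move=> le_ab adm; have [[_ defS] _] := adm; split=> /=.
  rewrite -joinIl; apply/join_idPr/no_crossing_meet_le => A B p1A p2B.
  exact: admissible_no_crossing adm p1A p2B.
by rewrite joinACA joinxx max_antichainU defS diff_joinK.
Qed.

Lemma solution_ge a b s : solution a b s -> (a <= s.1) && (a <= s.2).
Proof. by case=> <- _; rewrite leIl leIr. Qed.

Lemma solution_no_crossing a b s A B :
  solution a b s -> A \in achain s.1 -> B \in achain s.2 ->
  single (A :&: B) <= a.
Proof.
case=> meet_s _; have /meet_leP : s.1 `&` s.2 <= a by rewrite meet_s.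
exact.
Qed.

Lemma solution_swap a b s : solution a b s -> solution a b (s.2, s.1).
Proof. by case=> meet_s join_s; split; rewrite /= ?[s.2 `&` _]meetC // joinC. Qed.

(** A member [A] of [s.1 - a] is inside no member [B] of [s.2], since otherwise
    [A = A :&: B] would be below the meet [a], hence in [a]. So [A] is maximal
    in the union of [s.1] and [s.2], and survives in the join [b]. *)
Lemma solution_diff_sub a b s :
  solution a b s -> achain s.1 :\: achain a \subset achain b :\: achain a.
Proof.
move=> sol; have /andP[le_as1 _] := solution_ge sol.
apply/subsetP => A /setDP[s1A aA]; rewrite in_setD aA /=.
have [_ <-] := sol; rewrite joinacE.
apply: mem_max_antichain => [|B]; first by rewrite in_setU s1A.
rewrite in_setU => /orP[s1B sAB | s2B sAB]; first by rewrite (antichain_eq s1A s1B).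
case/negP: aA; apply: (mem_of_le le_as1 s1A).
by have := solution_no_crossing sol s1A s2B; rewrite (setIidPl sAB).
Qed.

(** Disjointness is the case [A = B] of [solution_no_crossing]. *)
Lemma solution_partition a b s :
  solution a b s ->
  is_partition2 (achain b :\: achain a)
    (achain s.1 :\: achain a, achain s.2 :\: achain a).
Proof.
move=> sol; have /andP[le_as1 _] := solution_ge sol; split=> /=.
  rewrite -setI_eq0; apply/eqP/setP => A; rewrite in_set0 in_setI.
  apply/negP => /andP[/setDP[s1A aA] /setDP[s2A _]].
  case/negP: aA; apply: (mem_of_le le_as1 s1A).
  by have := solution_no_crossing sol s1A s2A; rewrite setIid.
apply/eqP; rewrite eqEsubset subUset (solution_diff_sub sol).
rewrite (solution_diff_sub (solution_swap sol)) -setDUl setSD //.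
by apply/subsetP => A; have [_ <-] := sol; rewrite in_setU => /join_sub.
Qed.

(** A crossing direct connection would give an intersection not below the
    meet [a]. *)
Lemma solution_step a b s A B :
  solution a b s -> A \in achain s.1 :\: achain a ->
  B \in achain b :\: achain a -> directly_connected a A B ->
  B \in achain s.1 :\: achain a.
Proof.
move=> sol /setDP[s1A _]; have [_ <-] := solution_partition sol.
rewrite in_setU => /orP[// | /setDP[s2B _]] /negP[].
exact: solution_no_crossing sol s1A s2B.
Qed.

Lemma solution_admissible a b s :
  solution a b s ->
  admissible a b (achain s.1 :\: achain a, achain s.2 :\: achain a).
Proof.
move=> sol; have part := solution_partition sol; split=> // A B baA baB conAB.
have [_ defS] := part.
have /= : A \in (achain s.1 :\: achain a) :|: (achain s.2 :\: achain a).
  by rewrite defS.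
rewrite in_setU => /orP[s1A | s2A]; [left | right]; split=> //.
  apply: connected_closed s1A baB conAB => X Y; exact: solution_step.
apply: connected_closed s2A baB conAB => X Y.
exact: (solution_step (solution_swap sol)).
Qed.

End AntichainLattice.

Theorem theorem5p4 (n : nat) (alpha beta : antichain n)
    (le_alpha_beta : (alpha <= beta)%O) :
  (forall p : {set {set 'I_n}} * {set {set 'I_n}},
     admissible alpha beta p ->
     exists! s : antichain n * antichain n,
       solution alpha beta s /\ corresponds alpha p s) /\
  (forall s : antichain n * antichain n,
     solution alpha beta s ->
     exists! p : {set {set 'I_n}} * {set {set 'I_n}},
       admissible alpha beta p /\ corresponds alpha p s).
Proof.
split=> [p adm | s sol].
  exists (max_antichain p.1 `|` alpha, max_antichain p.2 `|` alpha)%O; split.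
    split; first exact: admissible_solution.
    have [[_ defS] _] := adm.
    by split; rewrite /= (join_diffK le_alpha_beta) // -defS ?subsetUl ?subsetUr.
  move=> [chi upsilon] [sol [-> ->]] /=.
  have /andP[/= le_chi le_upsilon] := solution_ge sol.
  by rewrite !diff_joinK.
exists (achain s.1 :\: achain alpha, achain s.2 :\: achain alpha); split.
  by split; first exact: solution_admissible.
by move=> [p1 p2] [_ [/= -> ->]].
Qed.
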